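(* There is an inverse-free equation that is valid in all totally ordered groups, but not in all totally ordered monoids.
   Context: An $\ell$-group is an algebraic structure $\langle L,\wedge,\vee,\cdot,{}^{-1},\mathrm{e}\rangle$ such that $\langle L,\cdot,{}^{-1},\mathrm{e}\rangle$ is a group, $\langle L,\wedge,\vee\rangle$ is a lattice, and $a\le b$ implies $cad\le cbd$ for all $a,b,c,d\in L$, where $a\le b$ means $a\wedge b=a$. A distributive $\ell$-monoid is an algebraic structure $\langle M,\wedge,\vee,\cdot,\mathrm{e}\rangle$ such that $\langle M,\cdot,\mathrm{e}\rangle$ is a monoid, $\langle M,\wedge,\vee\rangle$ is a distributive lattice, and for all $a,b,c,d\in M$, $a(b\vee c)d=abd\vee acd$ and $a(b\wedge c)d=abd\wedge acd$. A totally ordered group (respectively, totally ordered monoid) is an $\ell$-group (respectively, distributive $\ell$-monoid) whose lattice order is total. An inverse-free equation is an equation $s\approx t$ where $s,t$ are terms in the signature $\wedge,\vee,\cdot,\mathrm{e}$. *)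

(* Defs.v *)
From mathcomp Require Import all_boot.

Set Implicit Arguments.
Unset Strict Implicit.
Unset Printing Implicit Defensive.

(* Carriers are arbitrary types: MathComp's groupType and
   latticeType would restrict them to choiceTypes. *)

(* Algebras in the signature (meet, join, product, unit). *)
Record lm_algebra := LmAlgebra {
  carrier :> Type;
  meet : carrier -> carrier -> carrier;
  join : carrier -> carrier -> carrier;
  mul : carrier -> carrier -> carrier;
  one : carrier
}.
Arguments one {_}.

(* Algebras in the signature (meet, join, product, inverse, unit). *)
Record lg_algebra := LgAlgebra {
  inverse_free_reduct :> lm_algebra;
  inv : inverse_free_reduct -> inverse_free_reduct
}.

Definition le (A : lm_algebra) (a b : A) : Prop := meet a b = a.

Definition total_le (A : lm_algebra) : Prop :=
  forall a b : A, le a b \/ le b a.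

Record is_monoid (A : lm_algebra) : Prop := IsMonoid {
  mul_assoc : associative (@mul A);
  one_mul : left_id one (@mul A);
  mul_one : right_id one (@mul A)
}.

Record is_group (G : lg_algebra) : Prop := IsGroup {
  group_monoid : is_monoid G;
  inv_mul : left_inverse one (@inv G) (@mul G);
  mul_inv : right_inverse one (@inv G) (@mul G)
}.

Record is_lattice (A : lm_algebra) : Prop := IsLattice {
  meet_assoc : associative (@meet A);
  join_assoc : associative (@join A);
  meet_comm : commutative (@meet A);
  join_comm : commutative (@join A);
  meet_joinK : forall a b : A, meet a (join a b) = a;
  join_meetK : forall a b : A, join a (meet a b) = a
}.

Record is_distributive_lattice (A : lm_algebra) : Prop :=
  IsDistributiveLattice {
    distributive_lattice_lattice : is_lattice A;
    meet_joinr : right_distributive (@meet A) (@join A)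
  }.

Record is_lgroup (L : lg_algebra) : Prop := IsLgroup {
  lgroup_group : is_group L;
  lgroup_lattice : is_lattice L;
  lgroup_le_mul : forall a b c d : L,
    le a b -> le (mul (mul c a) d) (mul (mul c b) d)
}.

Record is_distributive_lmonoid (M : lm_algebra) : Prop :=
  IsDistributiveLmonoid {
    lmonoid_monoid : is_monoid M;
    lmonoid_lattice : is_distributive_lattice M;
    lmonoid_mul_join : forall a b c d : M,
      mul (mul a (join b c)) d = join (mul (mul a b) d) (mul (mul a c) d);
    lmonoid_mul_meet : forall a b c d : M,
      mul (mul a (meet b c)) d = meet (mul (mul a b) d) (mul (mul a c) d)
  }.

Definition is_totally_ordered_group (G : lg_algebra) : Prop :=
  is_lgroup G /\ total_le G.

Definition is_totally_ordered_monoid (M : lm_algebra) : Prop :=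
  is_distributive_lmonoid M /\ total_le M.

(* Terms in the inverse-free signature over the variables x_0, x_1, ... *)
Inductive term : Type :=
  | Var of nat
  | Meet of term & term
  | Join of term & term
  | Mul of term & term
  | One.

Fixpoint eval (A : lm_algebra) (v : nat -> A) (t : term) : A :=
  match t with
  | Var i => v i
  | Meet t1 t2 => meet (eval v t1) (eval v t2)
  | Join t1 t2 => join (eval v t1) (eval v t2)
  | Mul t1 t2 => mul (eval v t1) (eval v t2)
  | One => one
  end.

Record inverse_free_equation := InverseFreeEquation {
  lhs : term;
  rhs : term
}.

Definition valid (A : lm_algebra) (E : inverse_free_equation) : Prop :=
  forall v : nat -> A, eval v (lhs E) = eval v (rhs E).

(* Main.v *)
Require Import Defs.
From mathcomp Require Import all_boot.
(* Lets [mul], [one] and [inv] again denote the operations of the algebras. *)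
Import Defs.

Set Implicit Arguments.
Unset Strict Implicit.
Unset Printing Implicit Defensive.

(** The equation expresses, for four variables [a], [b], [c], [d],
[[
  cbb /\ dba /\ bac /\ acb  <=  cca \/ dab \/ bbb \/ abc .
]]
    In a totally ordered set it fails exactly when every word on the left is
    strictly above every word on the right. Pairing the words off in the given
    order and cancelling the common outer letter, such a failure in a group
    says [bb > ca], [ba > ab], [ac > bb] and [cb > bc], that is,
[[
  c^-1 b > a b^-1 > b^-1 a > b c^-1 > c^-1 b ,
]]
    which is absurd. This is Malcev's obstruction to embedding a cancellative
    semigroup in a group, read with inequalities in place of equations. The
    outer letters move the four comparisons, which take place at different
    heights, to one common threshold, as a meet lying above a join demands;
    without them, [bb] would occur on both sides and the equation would be
    trivial.

    For the countermodel, choose a set [H] of words over the letters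
    [a < b < c < d] which contains the four words on the left and none of those
    on the right, no word of length at most 2, and every word of length at
    least 4. Compare two words [u] and [v] by asking that [puq] in [H] imply
    [pvq] in [H] for all [p] and [q]. This preorder is compatible with
    concatenation, so if it is total, then the quotient of the free monoid is a
    totally ordered monoid in which the words of [H] of length 3 lie strictly
    above the other words of length 3; hence the equation fails in it. A
    suitable [H] is read off the table below: the quotient is a chain of 13
    elements, and the required properties of its multiplication are a finite
    computation, [table_ordered_monoid]. *)

(** * Lattices *)

Section Lattice.

Variables (A : lm_algebra) (latA : is_lattice A).
Implicit Types x y z : A.

Lemma meet_idem x : meet x x = x.
Proof. by rewrite -{2}(join_meetK latA x x) (meet_joinK latA). Qed.

Lemma le_trans y x z : le x y -> le y z -> le x z.
Proof. by rewrite /le => xy yz; rewrite -xy -(meet_assoc latA) yz. Qed.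

Lemma meet_le_l x y z : le x z -> le (meet x y) z.
Proof.
apply: le_trans; rewrite /le (meet_comm latA) (meet_assoc latA).
by rewrite meet_idem.
Qed.

Lemma meet_le_r x y z : le y z -> le (meet x y) z.
Proof. by rewrite (meet_comm latA); apply: meet_le_l. Qed.

Lemma le_join_l x y z : le z x -> le z (join x y).
Proof. by move/le_trans; apply; apply: (meet_joinK latA). Qed.

Lemma le_join_r x y z : le z y -> le z (join x y).
Proof. by rewrite (join_comm latA); apply: le_join_l. Qed.

Lemma le_join_eq x y : le x y -> join x y = y.
Proof.
move=> xy; rewrite -[in LHS]xy (join_comm latA) (meet_comm latA).
exact: (join_meetK latA).
Qed.

End Lattice.

(** * The equation in totally ordered groups *)

Definition separating_equation : inverse_free_equation :=
  let a := Var 0 in let b := Var 1 in let c := Var 2 in let d := Var 3 in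
  let word x y z := Mul (Mul x y) z in
  let lower :=
    Meet (Meet (word c b b) (word d b a)) (Meet (word b a c) (word a c b)) in
  let upper :=
    Join (Join (word c c a) (word d a b)) (Join (word b b b) (word a b c)) in
  InverseFreeEquation (Join lower upper) upper.

Declare Scope lm_scope.
Local Notation "x * y" := (mul x y) : lm_scope.
Local Notation "x ^-1" := (inv x) : lm_scope.

Section Group.

Local Open Scope lm_scope.

Variables (G : lg_algebra) (lgG : is_lgroup G).
Implicit Types a b c d x y : G.

Let monG : is_monoid G := group_monoid (lgroup_group lgG).

Let latG : is_lattice G := lgroup_lattice lgG.

Let mulgA : associative (@mul G) := mul_assoc monG.

Lemma mulgK x y : x * y * y^-1 = x.
Proof. by rewrite -mulgA (mul_inv (lgroup_group lgG)) (mul_one monG). Qed.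

Lemma mulgVK x y : x * y^-1 * y = x.
Proof. by rewrite -mulgA (inv_mul (lgroup_group lgG)) (mul_one monG). Qed.

Lemma mulKg x y : y^-1 * (y * x) = x.
Proof. by rewrite mulgA (inv_mul (lgroup_group lgG)) (one_mul monG). Qed.

Lemma mulVKg x y : y * (y^-1 * x) = x.
Proof. by rewrite mulgA (mul_inv (lgroup_group lgG)) (one_mul monG). Qed.

Lemma le_mul2l p x y : le x y -> le (p * x) (p * y).
Proof.
by move/(lgroup_le_mul lgG p one); rewrite !(mul_one monG).
Qed.

Lemma le_mul2r p x y : le x y -> le (x * p) (y * p).
Proof.
by move/(lgroup_le_mul lgG one p); rewrite !(one_mul monG).
Qed.

Lemma le_mul_cancel p x y : le (p * x) (p * y) -> le x y.
Proof. by move/(le_mul2l p^-1); rewrite !mulKg. Qed.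

Lemma le_left_quotient p u v x y :
  le (p * u * x) (p * v * y) -> le (v^-1 * u) (y * x^-1).
Proof.
rewrite -!mulgA => /le_mul_cancel /(le_mul2l v^-1) /(le_mul2r x^-1).
by rewrite mulKg mulgA mulgK.
Qed.

Lemma le_right_quotient p u v x y :
  le (p * u * x) (p * v * y) -> le (x * y^-1) (u^-1 * v).
Proof.
rewrite -!mulgA => /le_mul_cancel /(le_mul2l u^-1) /(le_mul2r y^-1).
by rewrite mulKg mulgA mulgK.
Qed.

(** If the last three comparisons of the cycle hold weakly, they chain up to
    [c^-1 b <= b c^-1 <= b^-1 a <= a b^-1], which is the reverse of the first
    comparison. Working with weak inequalities avoids having to decide
    equality in [G]. *)
Lemma le_of_quotient_cycle a b c d :
    le (d * a * b) (d * b * a) ->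
    le (b * b * b) (b * a * c) ->
    le (a * b * c) (a * c * b) ->
  le (c * b * b) (c * c * a).
Proof.
move=> /le_left_quotient ab /le_right_quotient bbac /le_left_quotient bc.
have: le (c^-1 * b) (a * b^-1).
  exact: (le_trans latG bc (le_trans latG bbac ab)).
move=> /(le_mul2r b) /(le_mul2l c).
by rewrite mulgVK -mulgA mulVKg => /(le_mul2l c); rewrite !mulgA.
Qed.

Lemma separating_equation_valid : total_le G -> valid G separating_equation.
Proof.
move=> total v /=; apply: (le_join_eq latG).
set a := v 0; set b := v 1; set c := v 2; set d := v 3.
case: (total (d * b * a) (d * a * b)) => [le2|ge2].
  apply/(meet_le_l latG)/(meet_le_r latG).
  exact/(le_join_l latG)/(le_join_r latG).
case: (total (b * a * c) (b * b * b)) => [le3|ge3].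
  apply/(meet_le_r latG)/(meet_le_l latG).
  exact/(le_join_r latG)/(le_join_l latG).
case: (total (a * c * b) (a * b * c)) => [le4|ge4].
  apply/(meet_le_r latG)/(meet_le_r latG).
  exact/(le_join_r latG)/(le_join_r latG).
apply/(meet_le_l latG)/(meet_le_l latG)/(le_join_l latG)/(le_join_l latG).
exact: le_of_quotient_cycle ge2 ge3 ge4.
Qed.

End Group.

(** * Totally ordered monoids on an initial segment of the naturals *)

Section OrdinalMonoid.

Variables (n : nat) (op : 'I_n -> 'I_n -> 'I_n) (e : 'I_n).

Definition ordinal_algebra : lm_algebra :=
  LmAlgebra (fun i j : 'I_n => if i < j then i else j)
            (fun i j : 'I_n => if i < j then j else i) op e.

Lemma val_meet_ordinal (i j : ordinal_algebra) :
  meet i j = minn i j :> nat.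
Proof. by rewrite /= [LHS]fun_if. Qed.

Lemma val_join_ordinal (i j : ordinal_algebra) :
  join i j = maxn i j :> nat.
Proof. by rewrite /= [LHS]fun_if. Qed.

Lemma ordinal_distributive_lattice : is_distributive_lattice ordinal_algebra.
Proof.
pose E := (val_meet_ordinal, val_join_ordinal).
split; first split; move=> *; apply: val_inj; rewrite /= !E.
- exact: minnA.
- exact: maxnA.
- exact: minnC.
- exact: maxnC.
- by rewrite minnC maxnK.
- by rewrite maxnC minnK.
- exact: minn_maxr.
Qed.

Lemma ordinal_total_le : total_le ordinal_algebra.
Proof.
move=> i j; case/orP: (leq_total i j) => [ij|ji]; [left|right];
  by apply: ord_inj; rewrite val_meet_ordinal; apply/minn_idPl.
Qed.

Lemma monotone_meet_join (f : 'I_n -> 'I_n) (i j : ordinal_algebra) :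
    {homo f : i j / i <= j} ->
  (f (meet i j) = @meet ordinal_algebra (f i) (f j)) *
  (f (join i j) = @join ordinal_algebra (f i) (f j)).
Proof.
move=> homo_f; split; apply: ord_inj.
  rewrite [RHS]val_meet_ordinal /=.
  by case: ltnP => [/ltnW|] /homo_f; [move/minn_idPl|move/minn_idPr].
rewrite [RHS]val_join_ordinal /=.
by case: ltnP => [/ltnW|] /homo_f; [move/maxn_idPr|move/maxn_idPl].
Qed.

Hypotheses (opA : associative op) (op1 : left_id e op) (opr1 : right_id e op).
Hypothesis op_homo :
  forall i j k l : 'I_n, j <= k -> op (op i j) l <= op (op i k) l.

Lemma ordinal_ordered_monoid : is_totally_ordered_monoid ordinal_algebra.
Proof.
split; last exact: ordinal_total_le.
split; [by split|exact: ordinal_distributive_lattice|..] => a b c d;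
  have homo_ad : {homo (fun i => op (op a i) d) : i j / i <= j} by
    move=> i j; apply: op_homo.
- exact: (monotone_meet_join b c homo_ad).2.
- exact: (monotone_meet_join b c homo_ad).1.
Qed.

End OrdinalMonoid.

(** * The countermodel *)

(** The elements in increasing order: 0 is the unit; 1, 2, 3, 4 are the letters
    [a], [b], [c], [d]; 5, ..., 10 are the classes [aa = ab],
    [ba = ca = da], [bb], [ac = ad = bc = bd], [cb = cc = cd],
    [db = dc = dd] of words of length 2; 11 and 12 are the words of length 3
    outside and inside [H], and 12 also absorbs all longer words. The letter
    [i] followed by the class [k] lies in [H] exactly when [10 <= i + k], which
    determines [H]. *)
Definition table : seq (seq nat) :=
  [:: [::  0;  1;  2;  3;  4;  5;  6;  7;  8;  9; 10; 11; 12];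
      [::  1;  5;  5;  8;  8; 11; 11; 11; 11; 12; 12; 12; 12];
      [::  2;  6;  7;  8;  8; 11; 11; 11; 12; 12; 12; 12; 12];
      [::  3;  6;  9;  9;  9; 11; 11; 12; 12; 12; 12; 12; 12];
      [::  4;  6; 10; 10; 10; 11; 12; 12; 12; 12; 12; 12; 12];
      [::  5; 11; 11; 11; 11; 12; 12; 12; 12; 12; 12; 12; 12];
      [::  6; 11; 11; 12; 12; 12; 12; 12; 12; 12; 12; 12; 12];
      [::  7; 11; 11; 12; 12; 12; 12; 12; 12; 12; 12; 12; 12];
      [::  8; 11; 12; 12; 12; 12; 12; 12; 12; 12; 12; 12; 12];
      [::  9; 11; 12; 12; 12; 12; 12; 12; 12; 12; 12; 12; 12];
      [:: 10; 12; 12; 12; 12; 12; 12; 12; 12; 12; 12; 12; 12];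
      [:: 11; 12; 12; 12; 12; 12; 12; 12; 12; 12; 12; 12; 12];
      [:: 12; 12; 12; 12; 12; 12; 12; 12; 12; 12; 12; 12; 12]].

Definition table_mul (i j : nat) : nat := nth 0 (nth [::] table i) j.

(** Quantifying over a list of naturals, not over the finite type ['I_13],
    keeps the finite checks below computable by the kernel. *)
Lemma all_ordinal n (P : pred nat) :
  all P (iota 0 n) -> forall i : 'I_n, P i.
Proof. by move/allP=> allP i; apply: allP; rewrite mem_iota /=. Qed.

Lemma all2_ordinal n (P : nat -> nat -> bool) :
    all (fun i => all (P i) (iota 0 n)) (iota 0 n) ->
  forall i j : 'I_n, P i j.
Proof. by move=> allP i; apply: all_ordinal; exact: (all_ordinal allP i). Qed.

Lemma all3_ordinal n (P : nat -> nat -> nat -> bool) :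
    all (fun i => all (fun j => all (P i j) (iota 0 n)) (iota 0 n))
        (iota 0 n) ->
  forall i j k : 'I_n, P i j k.
Proof. by move=> allP i; apply: all2_ordinal; exact: (all_ordinal allP i). Qed.

Definition table_op (i j : 'I_13) : 'I_13 := inord (table_mul i j).

Lemma val_table_op i j : table_op i j = table_mul i j :> nat.
Proof.
rewrite inordK //; move: i j.
apply: (@all2_ordinal 13 (fun i j => table_mul i j < 13)).
by vm_compute.
Qed.

Definition table_algebra : lm_algebra := ordinal_algebra table_op ord0.

Lemma table_homo_l (i j k : 'I_13) :
  j <= k -> table_op i j <= table_op i k.
Proof.
rewrite !val_table_op; apply/implyP; move: i j k.
apply: (@all3_ordinal 13
  (fun i j k => (j <= k) ==> (table_mul i j <= table_mul i k))).
by vm_compute.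
Qed.

Lemma table_homo_r (i j k : 'I_13) :
  j <= k -> table_op j i <= table_op k i.
Proof.
rewrite !val_table_op; apply/implyP; move: i j k.
apply: (@all3_ordinal 13
  (fun i j k => (j <= k) ==> (table_mul j i <= table_mul k i))).
by vm_compute.
Qed.

Lemma table_ordered_monoid : is_totally_ordered_monoid table_algebra.
Proof.
apply: ordinal_ordered_monoid.
- move=> i j k; apply: val_inj; rewrite /= !val_table_op; apply/eqP.
  move: i j k; apply: (@all3_ordinal 13 (fun i j k =>
    table_mul i (table_mul j k) == table_mul (table_mul i j) k)).
  by vm_compute.
- move=> i; apply: val_inj; rewrite /= val_table_op; apply/eqP.
  move: i; apply: (@all_ordinal 13 (fun i => table_mul 0 i == i)).
  by vm_compute.
- move=> i; apply: val_inj; rewrite /= val_table_op; apply/eqP.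
  move: i; apply: (@all_ordinal 13 (fun i => table_mul i 0 == i)).
  by vm_compute.
- by move=> i j k l jk; apply/table_homo_r/table_homo_l.
Qed.

Lemma separating_equation_fails : ~ valid table_algebra separating_equation.
Proof.
pose v (i : nat) : table_algebra := inord i.+1.
pose valE := (@val_join_ordinal 13 table_op ord0,
              @val_meet_ordinal 13 table_op ord0, val_table_op).
(* The left side evaluates to 12, the right side to 11. *)
move=> /(_ v) /(congr1 (@nat_of_ord 13)); rewrite /= !valE.
by rewrite !inordK.
Qed.

Theorem theorem5p7 :
  exists E : inverse_free_equation,
    (forall G : lg_algebra, is_totally_ordered_group G -> valid G E) /\
    ~ (forall M : lm_algebra, is_totally_ordered_monoid M -> valid M E).
Proof.
exists separating_equation; split.
  by move=> G [lgG total]; apply: separating_equation_valid.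
by move/(_ _ table_ordered_monoid)/separating_equation_fails.
Qed.
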